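(* Let $\{f_{a_i}:\mathbb{R}^n\to\mathbb{R},\ i=1,\dots,k_a\}$ and $\{f_{b_j}:\mathbb{R}^n\to\mathbb{R},\ j=1,\dots,k_b\}$ be two finite families of functions ($k_a,k_b\geq 1$), and let $f_a(x)=\min_i f_{a_i}(x)$ and $f_b(x)=\min_j f_{b_j}(x)$. Let $C\subset\mathbb{R}^n$ be a non-empty feasible set and assume that the bi-objective problem $((f_a,f_b),C)$ satisfies the domination property. Then $$\mathrm{PS}^{((f_a,f_b),C)}=\mathrm{ND}^{((f_a,f_b),C)}\Big(\bigcup_{i,j}\mathrm{PS}^{((f_{a_i},f_{b_j}),C)}\Big).$$
   Context: For $f=(f_1,\dots,f_m):\mathbb{R}^n\to\mathbb{R}^m$ (to be minimized), $y$ dominates $x$ with respect to $f$, written $y\prec_f x$, if $f_i(y)\le f_i(x)$ for all $i$ and $f_j(y)<f_j(x)$ for some $j$. For $C\subset\mathbb{R}^n$, the Pareto set $\mathrm{PS}^{(f,C)}$ of the problem $(f,C)$ is the set of all $x\in C$ such that no $y\in C$ satisfies $y\prec_f x$. The problem $(f,C)$ satisfies the domination property if for all $x\in C\setminus\mathrm{PS}^{(f,C)}$ there exists $z\in\mathrm{PS}^{(f,C)}$ such that $z\prec_f x$. For $S\subset\mathbb{R}^n$, $\mathrm{ND}^{(f,C)}(S)$ is the set of all $y\in S\cap C$ such that no point of $S\cap C$ dominates $y$ with respect to $f$. *)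

(* Defs.v *)
From mathcomp Require Import all_boot all_order all_algebra.
From mathcomp Require Import classical_sets reals.

Set Implicit Arguments.
Unset Strict Implicit.
Unset Printing Implicit Defensive.

Import Order.TTheory GRing.Theory Num.Theory.

Local Open Scope ring_scope.
Local Open Scope classical_set_scope.

(* Objectives are minimized; [dominates f y x] is y \prec_f x. *)
Definition dominates (R : realType) (n m : nat) (f : 'rV[R]_n -> 'rV[R]_m)
    (y x : 'rV[R]_n) : Prop :=
  (forall i : 'I_m, f y ord0 i <= f x ord0 i) /\
  (exists j : 'I_m, f y ord0 j < f x ord0 j).

Definition pareto_set (R : realType) (n m : nat) (f : 'rV[R]_n -> 'rV[R]_m)
    (C : set 'rV[R]_n) : set 'rV[R]_n :=
  [set x | C x /\ ~ (exists y, C y /\ dominates f y x)].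

Definition domination_property (R : realType) (n m : nat)
    (f : 'rV[R]_n -> 'rV[R]_m) (C : set 'rV[R]_n) : Prop :=
  forall x, (C `\` pareto_set f C) x ->
    exists z, pareto_set f C z /\ dominates f z x.

Definition nondominated (R : realType) (n m : nat) (f : 'rV[R]_n -> 'rV[R]_m)
    (C S : set 'rV[R]_n) : set 'rV[R]_n :=
  [set y | (S `&` C) y /\ ~ (exists z, (S `&` C) z /\ dominates f z y)].

Definition biobjective (R : realType) (n : nat) (g h : 'rV[R]_n -> R) :
    'rV[R]_n -> 'rV[R]_2 :=
  fun x => \row_(i < 2) (if i == ord0 then g x else h x).

(* The family has k.+1 >= 1 members. Since the initial value of the iterated
   minimum is itself a member, this is exactly min_i (f i x). *)
Definition min_family (R : realType) (n k : nat)
    (f : 'I_k.+1 -> 'rV[R]_n -> R) : 'rV[R]_n -> R :=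
  fun x => \big[Num.min/f ord0 x]_(i < k.+1) f i x.

(* Main.v *)
(** A point [x] that is Pareto optimal for the minima is Pareto optimal for the
    pair [(f_{a_i}, f_{b_j})] of members attaining the minima at [x]: a point
    improving that pair improves the minima as well. Conversely, by the
    domination property, a point outside the Pareto set is dominated by a
    Pareto optimal point, which lies in the union by the first part. *)
Require Import Defs.
From mathcomp Require Import all_boot all_order all_algebra.
From mathcomp Require Import boolp classical_sets reals.

Import Order.TTheory GRing.Theory Num.Theory.

Local Open Scope ring_scope.
Local Open Scope classical_set_scope.

Lemma dominates_biobjective (R : realType) (n : nat) (g h : 'rV[R]_n -> R)
    (y x : 'rV[R]_n) :
  dominates (biobjective g h) y x <->
  [/\ g y <= g x, h y <= h x & g y < g x \/ h y < h x].
Proof.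
split=> [[le_yx [j lt_yx]]|[le_g le_h lt_yx]].
  (* The coordinates [ord0] and [ord_max] carry [g] and [h]; the test [j == ord0] decides which of
     them is strictly improved. *)
  have := le_yx ord0; have := le_yx ord_max; rewrite !mxE /= => le_h le_g.
  by split=> //; move: lt_yx; rewrite !mxE; case: ifP => _; [left|right].
split=> [i|]; first by rewrite !mxE; case: ifP.
by case: lt_yx => lt_yx; [exists ord0|exists ord_max]; rewrite !mxE.
Qed.

Lemma min_family_le (R : realType) (n k : nat) (f : 'I_k.+1 -> 'rV[R]_n -> R)
    (i : 'I_k.+1) (x : 'rV[R]_n) :
  min_family f x <= f i x.
Proof. exact: bigmin_le_cond. Qed.

(** Values of the form [f i x] are closed under binary minimum, and the seed [f ord0 x] of the
    iteration is already one of them. *)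
Lemma min_family_attained (R : realType) (n k : nat)
    (f : 'I_k.+1 -> 'rV[R]_n -> R) (x : 'rV[R]_n) :
  exists i, min_family f x = f i x.
Proof.
rewrite /min_family; apply: (big_ind (fun v => exists i, v = f i x)).
- by exists ord0.
- move=> _ _ [i ->] [j ->].
  by rewrite /Num.min; case: ifP => _; [exists i|exists j].
- by move=> i _; exists i.
Qed.

Lemma pareto_set_min_family_subset (R : realType) (n ka kb : nat)
    (fa : 'I_ka.+1 -> 'rV[R]_n -> R) (fb : 'I_kb.+1 -> 'rV[R]_n -> R)
    (C : set 'rV[R]_n) :
  pareto_set (biobjective (min_family fa) (min_family fb)) C `<=`
  \bigcup_(i in [set: 'I_ka.+1]) \bigcup_(j in [set: 'I_kb.+1])
    pareto_set (biobjective (fa i) (fb j)) C.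
Proof.
move=> x [Cx nondom_x].
have [i min_a] := min_family_attained _ _ _ fa x.
have [j min_b] := min_family_attained _ _ _ fb x.
exists i => //; exists j => //; split=> // -[y [Cy]].
rewrite dominates_biobjective => -[le_a le_b lt_ab]; apply: nondom_x.
(* The indices [i] and [j] need not attain the minima at [y]: the chain [min_family fa y <= fa i y
   <= fa i x = min_family fa x] suffices, and likewise for [fb]. *)
exists y; split=> //; rewrite dominates_biobjective min_a min_b; split.
- exact: le_trans (min_family_le _ _ _ _ _ _) le_a.
- exact: le_trans (min_family_le _ _ _ _ _ _) le_b.
- case: lt_ab => lt_yx; [left|right];
    exact: le_lt_trans (min_family_le _ _ _ _ _ _) lt_yx.
Qed.

Theorem corollary3p12 (R : realType) (n ka kb : nat)
    (fa : 'I_ka.+1 -> 'rV[R]_n -> R) (fb : 'I_kb.+1 -> 'rV[R]_n -> R)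
    (C : set 'rV[R]_n) (C_nonempty : C !=set0)
    (C_dom : domination_property
               (biobjective (min_family fa) (min_family fb)) C) :
  pareto_set (biobjective (min_family fa) (min_family fb)) C =
  nondominated (biobjective (min_family fa) (min_family fb)) C
    (\bigcup_(i in [set: 'I_ka.+1]) \bigcup_(j in [set: 'I_kb.+1])
       pareto_set (biobjective (fa i) (fb j)) C).
Proof.
apply/seteqP; split=> x.
  move=> PSx; have [Cx nondom_x] := PSx; split.
    by split=> //; apply: pareto_set_min_family_subset.
  (* Restricting the competitors to a part of [C] creates no new dominator. *)
  by move=> [z [[_ Cz] dom_z]]; apply: nondom_x; exists z.
move=> [[_ Cx] nondom_x]; apply: contrapT => notPSx.
(* An arbitrary dominator of [x] in [C] could lie outside the union and would not contradict
   [nondom_x]; a Pareto optimal one does. *)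
have [z [PSz dom_z]] := C_dom x (conj Cx notPSx).
apply: nondom_x; exists z; split=> //; split; last by case: PSz.
exact: pareto_set_min_family_subset.
Qed.
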